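(* Let $(X,\rho)$ be a compact metric space, and let $T:X\to X$ be a homeomorphism that is $L$-Lipschitz with respect to $\rho$, where $L>1$. Suppose $\mu$ is a regular Borel probability measure on $X$ such that $T$ is ergodic with respect to $\mu$. Let $(r_k)_{k=1}^\infty$ be a sequence of positive numbers for which there exists a constant $\gamma\in\mathbb{R}$ such that $r_k\le\gamma\cdot L^{-k}$ for all $k\in\mathbb{N}$. Let $B_k(x)=\{y\in X:\rho(x,y)<r_k\}$. Then the set of $x\in X$ such that $$\frac1k\sum_{i=0}^{k-1}\alpha_{B_k(x)}\left(T^i f\right)\;\xrightarrow{k\to\infty}\;\int f\,\mathrm{d}\mu\quad\text{for all } f\in C(X)$$ is of full $\mu$-measure.
   Context: $L$-Lipschitz means $\rho(Tx,Ty)\le L\,\rho(x,y)$ for all $x,y$. Ergodic includes that $\mu$ is $T$-invariant. $T^i f$ denotes $f\circ T^i$; $C(X)$ is the space of complex-valued continuous functions. For measurable $F$ with $\mu(F)>0$, $\alpha_F(f)=\frac1{\mu(F)}\int_Ff\,\mathrm{d}\mu$. For every $x\in\operatorname{supp}(\mu)$, hence for almost every $x$, $\mu(B_k(x))>0$ for all $k$, so the averages are defined for almost every $x$. *)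

(* Defs.v *)
From HB Require Import structures.
From mathcomp Require Import all_boot all_order all_algebra.
From mathcomp Require Import all_classical all_reals all_analysis.
From mathcomp Require Import complex.

Set Implicit Arguments.
Unset Strict Implicit.
Unset Printing Implicit Defensive.

Import Order.TTheory GRing.Theory Num.Theory.
Import numFieldNormedType.Exports.

Local Open Scope classical_set_scope.
Local Open Scope ring_scope.
Local Open Scope complex_scope.

(* [measurableType] extends [pointedType], so the Borel space of a metric space
   needs a distinguished point.  A space that carries a probability measure is
   nonempty, so the point is no restriction. *)
#[short(type="pmetricType")]
HB.structure Definition PointedMetric (K : numDomainType) :=
  {M of Pointed M & Metric K M}.

(* The library's topology and norm of a [numFieldType], here given by the complex
   modulus, attached to the type [R[i]]. *)
HB.instance Definition _ (R : realType) :=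
  NormedModule.copy R[i] ((R[i] : numFieldType) : Type).

Notation borel X := (g_sigma_algebraType (@open X)).

Definition homeomorphism (X Y : topologicalType) (T : X -> Y) : Prop :=
  continuous T /\
  exists S : Y -> X, [/\ continuous S, cancel T S & cancel S T].

Definition metric_lipschitz (R : realType) (X Y : metricType R) (L : R)
    (T : X -> Y) : Prop :=
  forall x y : X, mdist (T x) (T y) <= L * mdist x y.

Definition regular_measure (R : realType) (X : pmetricType R)
    (mu : {measure set borel X -> \bar R}) : Prop :=
  forall A : set X, (@open X).-sigma.-measurable A ->
    mu A = ereal_inf [set mu U | U in [set U : set X | open U /\ A `<=` U]] /\
    mu A = ereal_sup [set mu K | K in [set K : set X | compact K /\ K `<=` A]].

Section dynamics.
Context d (X : measurableType d) (R : realType).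
Implicit Types (mu : {measure set X -> \bar R}) (T : X -> X).

Definition measure_preserving mu T : Prop :=
  measurable_fun setT T /\
  forall A : set X, measurable A -> mu (T @^-1` A) = mu A.

Definition ergodic (mu : probability X R) T : Prop :=
  measure_preserving mu T /\
  forall A : set X, measurable A -> T @^-1` A = A ->
    mu A = 0%E \/ mu A = 1%E.

Definition cintegral mu (D : set X) (f : X -> R[i]) : R[i] :=
  Rintegral mu D (fun x => complex.Re (f x)) +i*
  Rintegral mu D (fun x => complex.Im (f x)).

(* Meaningful only when [0 < mu F < +oo]. *)
Definition average mu (F : set X) (f : X -> R[i]) : R[i] :=
  ((fine (mu F))^-1)%:C * cintegral mu F f.

End dynamics.

(* Main.v *)
(* By the Lipschitz condition T^i maps the ball of radius r_k around x into a
   ball of radius gamma L^(i-k) around T^i x, so by uniform continuity all but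
   boundedly many of the averages of T^i f, i < k, are close to f(T^i x).  The
   claim thus reduces to Birkhoff's theorem, for all continuous f at once.

   Birkhoff's theorem for a bounded g: by Garsia's argument, if the Birkhoff sums
   of g are unbounded above on a set of measure 1, then the integral of g is
   nonnegative.  That set is strictly invariant, so by ergodicity a negative
   integral forces the sums to be bounded above almost everywhere; apply this to
   f - (integral of f) - 1/(m+1) and to -f.  The exceptional set is made
   independent of f by applying the theorem to the indicators of countably many
   cells, whose combinations approximate every continuous function uniformly. *)

From HB Require Import structures.
Require Import Defs.
From mathcomp Require Import all_boot all_order all_algebra.
From mathcomp Require Import all_classical all_reals all_analysis.
From mathcomp Require Import complex.
From mathcomp Require Import measurable_realfun.
From mathcomp Require Import zify lra.

Set Implicit Arguments.
Unset Strict Implicit.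
Unset Printing Implicit Defensive.

Import Order.TTheory GRing.Theory Num.Theory.
Import numFieldNormedType.Exports.

Local Open Scope classical_set_scope.
Local Open Scope ring_scope.

Lemma exists_invS_le (R : realType) (e : R) :
  0 < e -> exists n : nat, n.+1%:R^-1 <= e.
Proof.
move=> e0; exists (Num.truncn e^-1); rewrite invf_ple ?posrE//.
exact/ltW/truncnS_gt.
Qed.

(** * Birkhoff sums and their running maxima *)

Section birkhoff_sum.
Context (X : Type) (R : realDomainType).
Implicit Types (T : X -> X) (g : X -> R).

Definition birkhoff_sum T g (n : nat) (x : X) : R :=
  \sum_(0 <= i < n) g (iter i T x).

(* The maximum of the Birkhoff sums of orders [0, ..., n]. *)
Fixpoint birkhoff_max T g (n : nat) (x : X) : R :=
  if n is n'.+1 then Num.max 0 (g x + birkhoff_max T g n' (T x)) else 0.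

Lemma birkhoff_sumS T g n x :
  birkhoff_sum T g n.+1 x = g x + birkhoff_sum T g n (T x).
Proof.
rewrite /birkhoff_sum big_nat_recl//; congr (_ + _).
by apply: eq_bigr => i _; rewrite -iterSr.
Qed.

Lemma birkhoff_max_ge0 T g n x : 0 <= birkhoff_max T g n x.
Proof. by case: n => //= n; rewrite le_max lexx. Qed.

Lemma birkhoff_max_leS T g n x :
  birkhoff_max T g n x <= birkhoff_max T g n.+1 x.
Proof.
elim: n x => [|n IH] x; first exact: (birkhoff_max_ge0 T g 1).
rewrite /= ge_max le_max lexx/= le_max; apply/orP; right.
by rewrite lerD2l; exact: IH.
Qed.

Lemma birkhoff_sum_le_max T g n x :
  birkhoff_sum T g n x <= birkhoff_max T g n x.
Proof.
elim: n x => [|n IH] x; first by rewrite /birkhoff_sum big_geq.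
by rewrite birkhoff_sumS /= le_max lerD2l IH orbT.
Qed.

(** A crude bound that serves to make the maxima integrable. *)
Lemma birkhoff_max_le T g C n x : (forall y, `|g y| <= C) ->
  birkhoff_max T g n x <= C *+ n.
Proof.
move=> gC; elim: n x => [|n IH] x //=.
have C0 : 0 <= C by exact: le_trans (gC x).
rewrite ge_max mulrn_wge0//= mulrS lerD//.
by rewrite (le_trans (ler_norm _)).
Qed.

End birkhoff_sum.

(** * Birkhoff's ergodic theorem for bounded measurable functions *)

Section birkhoff.
Context d (X : measurableType d) (R : realType).
Implicit Types (mu : probability X R) (T : X -> X) (f g : X -> R).

Lemma measurable_birkhoff_sum T g n : measurable_fun setT T ->
  measurable_fun setT g -> measurable_fun setT (birkhoff_sum T g n).
Proof.
move=> mT mg; elim: n => [|n IH].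
  by rewrite (_ : birkhoff_sum T g 0 = cst 0)//; apply/funext => x;
    rewrite /birkhoff_sum big_geq.
rewrite (_ : birkhoff_sum T g n.+1 = g \+ (birkhoff_sum T g n \o T)).
  by apply: measurable_funD => //; exact: measurableT_comp.
by apply/funext => x; rewrite birkhoff_sumS.
Qed.

Lemma measurable_birkhoff_max T g n : measurable_fun setT T ->
  measurable_fun setT g -> measurable_fun setT (birkhoff_max T g n).
Proof.
move=> mT mg; elim: n => [|n IH]; first exact: measurable_cst.
apply: measurable_maxr; first exact: measurable_cst.
by apply: measurable_funD => //; exact: measurableT_comp.
Qed.

Lemma bounded_fun_integrable mu f C : measurable_fun setT f ->
  (forall x, `|f x| <= C) -> mu.-integrable setT (EFin \o f).
Proof.
move=> mf fC; apply: measurable_bounded_integrable => //.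
  by rewrite (le_lt_trans (probability_le1 mu _))// ltry.
exists C; split; first by rewrite num_real.
by move=> D CD x _ /=; exact: le_trans (fC x) (ltW CD).
Qed.

(** Change of variables: the pushforward of [mu] under [T] agrees with [mu] on measurable sets. *)
Lemma Rintegral_comp_preserving mu T f C : measure_preserving mu T ->
  measurable_fun setT f -> (forall x, `|f x| <= C) ->
  Rintegral mu setT (f \o T) = Rintegral mu setT f.
Proof.
move=> [mT muT] mf fC; rewrite /Rintegral; congr fine.
pose mT_mixin := isMeasurableFun.Build _ _ _ _ _ mT.
pose T' : {mfun X >-> X} := HB.pack T mT_mixin.
rewrite -[LHS](@integral_pushforward _ _ _ _ _ T' _ _ setT (EFin \o f)) //.
- by apply: eq_measure_integral => A mA _; exact: muT.
- exact/measurable_EFinP.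
- apply: (@bounded_fun_integrable mu (f \o T) C) => [|x]; last exact: fC.
  exact: measurableT_comp.
Qed.

(* Integrates the pointwise inequality
   [M_n <= g + M_n \o T + C * \1_{M_n <= 0}], where [M_n] is [birkhoff_max]. *)
Lemma birkhoff_max_ineq mu T g C n : measure_preserving mu T ->
  measurable_fun setT g -> (forall x, `|g x| <= C) ->
  0 <= Rintegral mu setT g +
       C * fine (mu [set x | birkhoff_max T g n x <= 0]).
Proof.
move=> Tmp mg gC; have mT := Tmp.1.
set M := birkhoff_max T g n; set N := [set x | _].
have C0 : 0 <= C by exact: le_trans (gC point).
have mM : measurable_fun setT M by exact: measurable_birkhoff_max.
have bM x : `|M x| <= C *+ n.
  by rewrite ger0_norm ?birkhoff_max_ge0//; exact: birkhoff_max_le.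
have mN : measurable N.
  rewrite -[N]setTI; rewrite (_ : N = M @^-1` `]-oo, 0]); last first.
    by apply/seteqP; split => x /=; rewrite in_itv.
  by apply: mM => //; exact: measurable_itv.
have iM := bounded_fun_integrable mu mM bM.
have mMT : measurable_fun setT (M \o T) by exact: measurableT_comp.
have iMT := bounded_fun_integrable mu mMT (fun x => bM (T x)).
have ig := bounded_fun_integrable mu mg gC.
have mI : measurable_fun setT (fun x => C * \1_N x : R).
  by apply: measurable_funM => //; exact: measurable_indic.
have iI : mu.-integrable setT (EFin \o (fun x => C * \1_N x : R)).
  apply: (@bounded_fun_integrable _ _ C) => // x.
  by rewrite indicE; case: (x \in N); rewrite ?mulr1 ?mulr0 ?normr0// ger0_norm.
have igMT : mu.-integrable setT (EFin \o (fun x => g x + (M \o T) x)).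
  exact: (integrableD measurableT ig iMT).
have : Rintegral mu setT M <=
    Rintegral mu setT (fun x => (g x + (M \o T) x) + C * \1_N x).
  apply: le_Rintegral => //.
    exact: (integrableD measurableT igMT iI).
  move=> x _; change (M x <= g x + M (T x) + C * \1_N x).
  (* On [N], [M x <= 0], while [g x >= - C] and [M (T x) >= 0], so the extra [C] suffices. Off [N],
     the maximum of order [n.+1] is at least [M x > 0], so it is attained by its second argument
     [g x + M (T x)]. *)
  rewrite indicE; have [xN|xN] := boolP (x \in N).
    have M0 : M x <= 0 by move: xN; rewrite inE.
    rewrite /= mulr1; have := birkhoff_max_ge0 T g n (T x); rewrite -/(M (T x)).
    by have := gC x; rewrite ler_norml => /andP[]; lra.
  have Mx0 : 0 < M x by move: xN; rewrite notin_setE /N /= => /negP; rewrite -ltNge.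
  rewrite mulr0 addr0; have := birkhoff_max_leS T g n x.
  rewrite -/(M x) => /le_trans; apply.
  rewrite /= ge_max lexx andbT.
  have := birkhoff_max_leS T g n x; rewrite -/(M x) /= => h.
  have := lt_le_trans Mx0 h; rewrite lt_max ltxx/=; exact: ltW.
(* By invariance [M] and [M \o T] have the same integral; the two cancel and the claim remains. *)
rewrite RintegralD// RintegralD// (Rintegral_comp_preserving Tmp mM bM).
rewrite RintegralZl//; last exact: integrable_indic.
have -> : Rintegral mu setT (fun x => \1_N x : R) = fine (mu N).
  by rewrite /Rintegral integral_indic// setIT.
lra.
Qed.

(** Thresholds are natural numbers, so that countable set operations suffice for measurability. *)
Definition birkhoff_unbounded T g : set X :=
  [set x | forall B : nat, exists k, B%:R < birkhoff_sum T g k x].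

Lemma measurable_birkhoff_unbounded T g : measurable_fun setT T ->
  measurable_fun setT g -> measurable (birkhoff_unbounded T g).
Proof.
move=> mT mg; rewrite (_ : birkhoff_unbounded T g =
  \bigcap_B \bigcup_k (birkhoff_sum T g k @^-1` `]B%:R, +oo[)).
  apply: bigcapT_measurable => B; apply: bigcupT_measurable => k.
  rewrite -[_ @^-1` _]setTI.
  by apply: (@measurable_birkhoff_sum T g k) => //; exact: measurable_itv.
apply/seteqP; split => x /= xE B.
  by move=> _; have [k Bk] := xE B; exists k => //=; rewrite in_itv/= andbT.
by have [k _ /=] := xE B I; rewrite in_itv/= andbT; exists k.
Qed.

(** The sum of order [k.+1] at [x] and that of order [k] at [T x] differ by [g x], so raising the
    threshold by some [m >= C] absorbs the difference. The equality is strict, as [ergodic]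
    demands. *)
Lemma birkhoff_unbounded_invariant T g C : (forall x, `|g x| <= C) ->
  T @^-1` birkhoff_unbounded T g = birkhoff_unbounded T g.
Proof.
move=> gC; have [m Cm] : exists m : nat, C <= m%:R.
  exists (Num.truncn C).+1; exact/ltW/truncnS_gt.
apply/seteqP; split => x /= xE B.
  have [k] := xE (B + m)%N; rewrite natrD => Bk; exists k.+1.
  rewrite birkhoff_sumS.
  by have := gC x; rewrite ler_norml => /andP[]; lra.
(* Order 0 is impossible: the empty sum does not exceed [B + m]. Hence a first term can be split
   off. *)
have [[|k]] := xE (B + m)%N.
  by rewrite /birkhoff_sum big_geq// ltNge ler0n.
rewrite birkhoff_sumS natrD => Bk; exists k.
by have := gC x; rewrite ler_norml => /andP[]; lra.
Qed.

(** If the unbounded set had measure 1, the decreasing sets [N n] would have a null intersection, so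
    [C * mu (N n)] would tend to 0 and [birkhoff_max_ineq] would make the integral of [g]
    nonnegative. *)
Lemma birkhoff_sum_bounded mu T g C : ergodic mu T ->
  measurable_fun setT g -> (forall x, `|g x| <= C) ->
  Rintegral mu setT g < 0 ->
  {ae mu, forall x, exists B : nat, forall k, birkhoff_sum T g k x <= B%:R}.
Proof.
move=> [Tmp Terg] mg gC g0; have mT := Tmp.1.
have mE := measurable_birkhoff_unbounded mT mg.
suff E0 : mu (birkhoff_unbounded T g) = 0%E.
  exists (birkhoff_unbounded T g); split => // x /= nB B.
  apply: contra_notP nB => /forallNP nk; exists B => k.
  by rewrite leNgt; apply/negP/nk.
have [//|E1] := Terg _ mE (birkhoff_unbounded_invariant T gC).
exfalso; pose N n := [set x | birkhoff_max T g n x <= 0].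
have mN n : measurable (N n).
  rewrite -[N n]setTI (_ : N n = birkhoff_max T g n @^-1` `]-oo, 0]); last first.
    by apply/seteqP; split => x /=; rewrite in_itv.
  by apply: (@measurable_birkhoff_max T g n) => //; exact: measurable_itv.
have mIN : measurable (\bigcap_n N n) by exact: bigcapT_measurable.
have IN0 : mu (\bigcap_n N n) = 0%E.
  apply/eqP; rewrite eq_le measure_ge0 andbT.
  (* A point in every [N n] has all its sums at most 0, hence already fails the threshold
     [B = 0]. *)
  rewrite -(_ : mu (~` birkhoff_unbounded T g) = 0%E).
    apply: le_measure; rewrite ?inE//; first exact: measurableC.
    move=> x xN /(_ 0%N)[k]; have := birkhoff_sum_le_max T g k x.
    by have := xN k I; rewrite /N /=; lra.
  by rewrite probability_setC// E1 subee.
have Nfin : (mu (N 0%N) < +oo)%E.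
  by rewrite (le_lt_trans (probability_le1 mu _))// ltry.
have Nni : nonincreasing_seq N.
  apply/nonincreasing_seqP => n; apply/subsetPset => x /=.
  by apply: le_trans; exact: birkhoff_max_leS.
have muN : mu (N n) @[n --> \oo] --> mu (\bigcap_n N n).
  exact: (nonincreasing_cvg_mu Nfin mN mIN Nni).
rewrite IN0 in muN.
have : C * fine (mu (N n)) @[n --> \oo] --> C * 0.
  by apply: cvgMl_tmp; exact: (fine_cvg muN).
rewrite mulr0 => /(@cvgrPdist_lt _ _ _ _ _)/(_ (- Rintegral mu setT g)).
rewrite oppr_gt0 => /(_ g0)[n _ /(_ n (leqnn n))] /=.
rewrite sub0r normrN => /(le_lt_trans (ler_norm _)).
have := birkhoff_max_ineq n Tmp mg gC; rewrite -/(N n); lra.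
Qed.


(** Each [g m] has integral [- m.+1%:R^-1 < 0], so its sums are bounded above almost everywhere, and
    the bound disappears after division by [k]. Letting [m] run over the naturals gives one null set
    for all [e]. *)
Lemma birkhoff_avg_upper mu T f C : ergodic mu T ->
  measurable_fun setT f -> (forall x, `|f x| <= C) ->
  {ae mu, forall x, forall e : R, 0 < e ->
    \forall k \near \oo,
      k%:R^-1 * birkhoff_sum T f k x <= Rintegral mu setT f + e}.
Proof.
move=> Terg mf fC; set a := Rintegral mu setT f.
have if_ := bounded_fun_integrable mu mf fC.
pose g (m : nat) x : R := f x - (a + m.+1%:R^-1).
have gsum m k x :
    birkhoff_sum T (g m) k x = birkhoff_sum T f k x - (a + m.+1%:R^-1) * k%:R.
  rewrite /birkhoff_sum /g sumrB; congr (_ - _).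
  by rewrite big_const_nat subn0 iter_addr_0 mulr_natr.
have : {ae mu, forall x, forall m, exists B : nat, forall k,
    birkhoff_sum T (g m) k x <= B%:R}.
  apply: ae_foralln => m.
  apply: (@birkhoff_sum_bounded _ _ _ (C + `|a + m.+1%:R^-1|)) => //.
  - exact: measurable_funB.
  - by move=> x; rewrite (le_trans (ler_normB _ _))// lerD.
  - rewrite RintegralB//; last exact: finite_measure_integrable_cst.
    rewrite Rintegral_cst//= probability_setT/= mulr1 -/a opprD addrA subrr.
    by rewrite sub0r oppr_lt0 invr_gt0 ltr0n.
apply: filterS => x gB e e0.
have [m me] : exists m : nat, m.+1%:R^-1 <= e / 2.
  by apply: exists_invS_le; rewrite divr_gt0.
have [B /(_ _) SB] := gB m.
near=> k.
have k0 : (0 < k)%N by near: k; exact: nbhs_infty_gt.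
have kR0 : 0 < k%:R :> R by rewrite ltr0n.
(* One half of [e] absorbs the bound [B] for large [k], the other half absorbs [m.+1%:R^-1]. *)
have kB : B%:R <= e / 2 * k%:R.
  rewrite mulrC -ler_pdivrMr ?divr_gt0//.
  by near: k; exact: nbhs_infty_ger.
rewrite mulrC ler_pdivrMr//; have := SB k; rewrite gsum mulrDl.
have : m.+1%:R^-1 * k%:R <= e / 2 * k%:R by rewrite ler_pM2r.
rewrite mulrDl; move: (m.+1%:R^-1 * k%:R) => u.
have -> : e / 2 * k%:R = e * k%:R / 2 by rewrite mulrAC.
by move: kB; rewrite mulrAC; lra.
Unshelve. all: by end_near. Qed.

Theorem birkhoff_ergodic mu T f C : ergodic mu T ->
  measurable_fun setT f -> (forall x, `|f x| <= C) ->
  {ae mu, forall x,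
    k%:R^-1 * birkhoff_sum T f k x @[k --> \oo] --> Rintegral mu setT f}.
Proof.
move=> Terg mf fC.
have mNf : measurable_fun setT (\- f) by exact: measurable_funN.
have NfC x : `|(\- f) x| <= C by rewrite normrN.
have if_ := bounded_fun_integrable mu mf fC.
have NfE : Rintegral mu setT (\- f) = - Rintegral mu setT f.
  rewrite -[RHS]mulN1r -RintegralZl//.
  by apply: eq_Rintegral => x _; rewrite mulN1r.
(* The upper estimate for [\- f] is the lower estimate for [f]. *)
have := birkhoff_avg_upper Terg mNf NfC; have := birkhoff_avg_upper Terg mf fC.
apply: filterS2 => x up low; apply/cvgrPdist_le => e e0.
near=> k.
have Uk : k%:R^-1 * birkhoff_sum T f k x <= Rintegral mu setT f + e.
  by near: k; exact: up.
have Lk : k%:R^-1 * birkhoff_sum T (\- f) k x <= Rintegral mu setT (\- f) + e.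
  by near: k; exact: low.
rewrite NfE in Lk.
have SE : birkhoff_sum T (\- f) k x = - birkhoff_sum T f k x.
  by rewrite /birkhoff_sum sumrN.
rewrite SE mulrN in Lk.
by rewrite ler_distlC; apply/andP; split; lra.
Unshelve. all: by end_near. Qed.

End birkhoff.

(** * Compact metric spaces: finite covers, nets, uniform continuity *)

Lemma ball_metric_open (R : realType) (X : metricType R) (x : X) (r : R) :
  open (ball x r).
Proof.
rewrite openE => y; rewrite ballEmdist /= => xy.
apply/nbhs_ballP; exists (r - mdist x y) => /=; first by rewrite subr_gt0.
move=> z; rewrite !ballEmdist /= => yz.
by rewrite (le_lt_trans (metric_triangle x y z))// -ltrBrDl.
Qed.

(** The radius may depend on the centre: constant radii yield nets, variable ones yield uniform
    continuity. *)
Lemma compact_ball_cover (R : realType) (X : pmetricType R) (r : X -> R) :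
  compact [set: X] -> (forall c, 0 < r c) ->
  exists s : seq X, forall x, exists2 c, c \in s & ball c (r c) x.
Proof.
rewrite compact_cover => cX r0.
have [] := cX X setT (fun c => ball c (r c)).
- by move=> c _; exact: ball_metric_open.
- by move=> x _; exists x => //; exact: ballxx.
move=> s _ sX; exists (finmap.enum_fset s) => x.
by have [c /= cs cx] := sX x I; exists c.
Qed.

Lemma compact_nets (R : realType) (X : pmetricType R) : compact [set: X] ->
  exists s : nat -> seq X,
    forall n x, exists2 c, c \in s n & ball c n.+1%:R^-1 x.
Proof.
move=> cX; have /choice[s sP] : forall n : nat, exists s : seq X,
    forall x, exists2 c, c \in s & ball c n.+1%:R^-1 x; last by exists s.
move=> n; apply: (@compact_ball_cover R X (fun=> n.+1%:R^-1) cX) => c.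
by rewrite invr_gt0 ltr0n.
Qed.

Lemma compact_uniformly_continuous (R : realType) (X : pmetricType R)
    (f : X -> R) (e : R) : compact [set: X] -> continuous f -> 0 < e ->
  exists2 d, 0 < d & forall x y, mdist x y < d -> `|f x - f y| < e.
Proof.
move=> cX cf e0.
have e20 : 0 < e / 2 by rewrite divr_gt0.
have /choice[r rP] : forall c, exists r : R,
    0 < r /\ forall y, mdist c y < r -> `|f c - f y| < e / 2.
  move=> c; have /cvgrPdist_lt/(_ _ e20)/nbhs_ballP[r /= r0 rP] := cf c.
  by exists r; split=> // y cy; apply: rP; rewrite ballEmdist.
have [|s sX] := @compact_ball_cover R X (fun c => r c / 2) cX.
  by move=> c; rewrite divr_gt0//; have [] := rP c.
(* The cover uses halved radii: if [x] is in the half ball at [c] and [y] is within [d] of [x], both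
   lie in the full ball at [c]. *)
have [d d0 ds] : exists2 d, 0 < d & forall c, c \in s -> d <= r c / 2.
  elim: {sX}s => [|c s [d d0 ds]]; first by exists 1.
  exists (Num.min (r c / 2) d).
    by rewrite lt_min d0 divr_gt0//; have [] := rP c.
  by move=> c'; rewrite inE ge_min => /predU1P[->|/ds->]; rewrite ?lexx ?orbT.
exists d => // x y xy.
have [c cs] := sX x; rewrite ballEmdist/= => cx.
have [rc0 rcP] := rP c.
have cx' : mdist c x < r c by apply: lt_le_trans cx _; lra.
have cy' : mdist c y < r c.
  by have := metric_triangle c x y; have := ds _ cs; lra.
have := rcP _ cx'; have := rcP _ cy'.
by rewrite !ltr_norml => /andP[? ?] /andP[? ?]; apply/andP; split; lra.
Qed.

Lemma compact_continuous_bounded (R : realType) (X : pmetricType R)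
    (f : X -> R) : compact [set: X] -> continuous f ->
  exists C, forall x, `|f x| <= C.
Proof.
move=> cX cf; have [d d0 dP] := compact_uniformly_continuous cX cf ltr01.
have [//|s sX] := @compact_ball_cover R X (fun=> d) cX.
(* The sum over the finitely many centres dominates each [|f c|]; the 1 is the oscillation over a
   ball of radius [d]. *)
exists (1 + \sum_(c <- s) `|f c|) => x.
have [c cs] := sX x; rewrite ballEmdist /= => /dP cx.
rewrite (big_rem c)//= addrA -[leLHS]addr0 lerD//; last exact: sumr_ge0.
by rewrite -lerBlDr (le_trans (lerB_dist _ _))// distrC ltW.
Qed.

(** * Borel probabilities: measurability and the mass of balls *)

Section borel_probability.
Context (R : realType) (X : pmetricType R).
Implicit Types (mu : probability (borel X) R) (f : X -> R).

Lemma open_borel_measurable (U : set X) :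
  open U -> measurable (U : set (borel X)).
Proof. by move=> oU; exact: sub_sigma_algebra. Qed.

Lemma continuous_borel_measurable f : continuous f ->
  measurable_fun setT (f : borel X -> R).
Proof.
move=> /continuousP cf; apply: (measurability _ (RGenOpens.measurableE R)).
move=> _ [_ [a [b ->] <-]]; rewrite setTI; apply: open_borel_measurable.
exact/cf/interval_open.
Qed.

Lemma ball_borel_measurable (x : X) (r : R) :
  measurable (ball x r : set (borel X)).
Proof. exact: open_borel_measurable (ball_metric_open _ _). Qed.

(** The null balls among the countably many net balls are discarded. Every ball around a remaining
    point contains a net ball through that point, which has positive mass. *)
Lemma ball_mass_gt0 mu : compact [set: X] ->
  {ae mu, forall x, forall r, 0 < r -> (0 < mu (ball x r))%E}.
Proof.
move=> cX.
have [s sP] := compact_nets cX.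
(* For [j] past the end of [s n] this is a ball around [point], a harmless extra member of the
   family. *)
pose U n j : set (borel X) := ball (nth point (s n) j) n.+1%:R^-1.
have mU n j : measurable (U n j).
  exact: ball_borel_measurable.
have : {ae mu, forall x, forall n j, U n j x -> (0 < mu (U n j))%E}.
  apply: ae_foralln => n; apply: ae_foralln => j.
  have [U0|U0] := eqVneq (mu (U n j)) 0%E.
    by exists (U n j); split => // x /= /not_implyP[].
  by apply: aeW => x _; rewrite lt0e U0/=.
apply: filterS => x xU r r0.
have [n nr] : exists n : nat, n.+1%:R^-1 <= r / 2.
  by apply: exists_invS_le; rewrite divr_gt0.
have [c cs cx] := sP n x.
have cE : nth point (s n) (index c (s n)) = c := nth_index _ cs.
have := xU n (index c (s n)); rewrite /U cE => /(_ cx)/lt_le_trans; apply.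
apply: le_measure; rewrite ?inE.
- exact: ball_borel_measurable.
- exact: ball_borel_measurable.
move=> y; move: cx nr; move: n.+1%:R^-1 => q; rewrite !ballEmdist/= => cx qr cy.
by have := metric_triangle x c y; rewrite (metric_sym x c); lra.
Qed.

End borel_probability.

(** * Estimates for integrals and finite averages *)

Lemma Rintegral_dist_le d (X : measurableType d) (R : realType)
    (mu : probability X R) (D : set X) (f g : X -> R) (e : R) :
  measurable D -> mu.-integrable D (EFin \o f) ->
  mu.-integrable D (EFin \o g) -> (forall x, D x -> `|f x - g x| <= e) ->
  `|Rintegral mu D f - Rintegral mu D g| <= e * fine (mu D).
Proof.
move=> mD if_ ig fg.
have ifg : mu.-integrable D (EFin \o (fun x => f x - g x)).
  exact: (integrableB mD if_ ig).
rewrite -RintegralB// (le_trans (le_normr_Rintegral mD ifg))//.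
rewrite -(Rintegral_cst mu mD); apply: le_Rintegral => //.
  exact: (integrable_norm ifg).
exact: finite_measure_integrable_cst.
Qed.

Lemma Rintegral_sum d (X : measurableType d) (R : realType)
    (mu : probability X R) (I : Type) (r : seq I) (F : I -> X -> R) :
  (forall i, mu.-integrable setT (EFin \o F i)) ->
  mu.-integrable setT (EFin \o (fun x => \sum_(i <- r) F i x)) /\
  Rintegral mu setT (fun x => \sum_(i <- r) F i x) =
    \sum_(i <- r) Rintegral mu setT (F i).
Proof.
move=> iF; elim: r => [|i r [IH1 IH2]].
  rewrite [X in EFin \o X](_ : _ = cst 0); last first.
    by apply/funext => x; rewrite big_nil.
  rewrite (eq_Rintegral _ (g := cst 0)) => [|x _]; last by rewrite big_nil.
  rewrite big_nil; split; first exact: finite_measure_integrable_cst.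
  by rewrite Rintegral_cst// mul0r.
rewrite [X in EFin \o X](_ : _ = fun x => F i x + \sum_(j <- r) F j x);
  last by apply/funext => x; rewrite big_cons.
rewrite (eq_Rintegral _ (g := fun x => F i x + \sum_(j <- r) F j x));
  last by move=> x _; rewrite big_cons.
split; first exact: (integrableD measurableT (iF i) IH1).
by rewrite RintegralD// IH2 big_cons.
Qed.

Lemma avg_dist_le (R : realType) (a b : nat -> R) (e : R) (k : nat) :
  0 <= e -> (forall i, `|a i - b i| <= e) ->
  `|k%:R^-1 * (\sum_(0 <= i < k) a i) - k%:R^-1 * (\sum_(0 <= i < k) b i)| <= e.
Proof.
move=> e0 ab; have [->|k0] := posnP k.
  by rewrite !big_geq// subrr normr0.
rewrite -mulrBr normrM ger0_norm ?invr_ge0// mulrC ler_pdivrMr ?ltr0n//.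
rewrite -sumrB (le_trans (ler_norm_sum _ _ _))//.
apply: (@le_trans _ _ (\sum_(0 <= i < k) e)); first exact: ler_sum.
by rewrite big_const_nat subn0 iter_addr_0 mulr_natr.
Qed.

(** * Birkhoff's theorem for all continuous functions off one null set *)

Section birkhoff_continuous.
Context (R : realType) (X : pmetricType R).
Variables (mu : probability (borel X) R) (T : X -> X).

Lemma birkhoff_continuous : compact [set: X] -> ergodic mu T ->
  {ae mu, forall x, forall f : X -> R, continuous f ->
    k%:R^-1 * (\sum_(0 <= i < k) f (iter i T x)) @[k --> \oo] -->
      Rintegral mu setT f}.
Proof.
move=> cX Terg.
have [s sP] := compact_nets cX.
pose U n j : set (borel X) := ball (nth point (s n) j) n.+1%:R^-1.
(* The cells: net balls made disjoint, each still contained in its ball. *)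
pose D n := seqDU (U n).
have mD n j : measurable (D n j).
  apply: seqDU_measurable => i.
  exact: ball_borel_measurable.
(* The indicators are countably many, so one null set, fixed before [f], serves them all. *)
have Dae : {ae mu, forall x, forall n j,
    k%:R^-1 * birkhoff_sum T (\1_(D n j) : _ -> R) k x @[k --> \oo] -->
      Rintegral mu setT (\1_(D n j) : _ -> R)}.
  apply: ae_foralln => n; apply: ae_foralln => j.
  apply: (@birkhoff_ergodic _ _ _ _ _ _ 1) => //.
  by move=> x; rewrite indicE; case: (_ \in _); rewrite ?normr1 ?normr0.
apply: (@filterS (borel X) (almost_everywhere mu) _ _ _ _ Dae) => x Dx f cf.
apply/cvgrPdist_le => e e0; have e30 : 0 < e / 3 by rewrite divr_gt0.
have [d d0 dP] := compact_uniformly_continuous cX cf e30.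
have [n nd] := exists_invS_le d0.
pose m := size (s n).
(* The step function taking on each cell the value of [f] at its centre. The first [m] balls cover
   the space, so the first [m] cells partition it. *)
pose h (y : borel X) : R :=
  \sum_(j < m) f (nth point (s n) j) * \1_(D n j) y.
have fh y : `|f y - h y| <= e / 3.
  have [c cs cy] := sP n y.
  have : (\big[setU/set0]_(j < m) D n j) y.
    rewrite -bigsetU_seqDU -bigcup_mkord; exists (index c (s n)).
      by rewrite /= index_mem.
    by rewrite /U nth_index.
  rewrite -bigcup_mkord => -[j /= jm Dj].
  rewrite /h (bigD1 (Ordinal jm))//= indicE mem_set// mulr1 big1 ?addr0.
    have := subset_seqDU Dj; rewrite /U ballEmdist/= => jy.
    by rewrite distrC ltW// dP// (lt_le_trans jy).
  move=> i ij; rewrite indicE memNset ?mulr0// => Di.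
  have /trivIsetP/(_ i j I I) := @trivIset_seqDU _ (U n).
  move: ij; rewrite -val_eqE/= => -> /(_ isT)/seteqP[/(_ y) + _].
  by apply; split.
have mf := continuous_borel_measurable cf.
have [C fC] := compact_continuous_bounded cX cf.
have if_ := bounded_fun_integrable mu mf fC.
have iD j : mu.-integrable setT (EFin \o (\1_(D n j) : _ -> R)).
  exact: integrable_indic.
have h_avg k : k%:R^-1 * (\sum_(0 <= i < k) h (iter i T x)) =
    \sum_(j < m) f (nth point (s n) j) *
      (k%:R^-1 * birkhoff_sum T (\1_(D n j) : _ -> R) k x).
  rewrite exchange_big/= mulr_sumr; apply: eq_bigr => j _.
  by rewrite -mulr_sumr mulrCA.
have ifD j : mu.-integrable setT
    (EFin \o (fun y => f (nth point (s n) j) * \1_(D n j) y)).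
  exact: (integrableZl measurableT _ (iD j)).
have [ih hE] := Rintegral_sum (index_enum 'I_m) ifD.
have intfh : `|Rintegral mu setT f - Rintegral mu setT h| <= e / 3.
  have := Rintegral_dist_le measurableT if_ ih (fun y _ => fh y).
  by rewrite /= probability_setT/= mulr1.
have hcvg : k%:R^-1 * (\sum_(0 <= i < k) h (iter i T x)) @[k --> \oo] -->
    Rintegral mu setT h.
  under eq_fun do rewrite h_avg.
  rewrite hE; apply: cvg_big => [|j _]; first exact: add_continuous.
  rewrite RintegralZl//.
  by apply: cvgMl_tmp; exact: Dx.
(* Three errors of [e / 3]: the integrals of [f] and [h], the convergence for [h], and the averages
   of [f] and [h]. *)
have /cvgrPdist_le/(_ _ e30) := hcvg; apply: filterS => k hk.
have := @avg_dist_le R (fun i => f (iter i T x)) (fun i => h (iter i T x))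
  (e / 3) k (ltW e30) (fun i => fh (iter i T x)).
move: hk intfh; set a := Rintegral mu setT f; set b := Rintegral mu setT h.
set u := _^-1 * (\sum_(_ <= i < _) f _); set v := _^-1 * (\sum_(_ <= i < _) h _).
rewrite !ler_norml => /andP[? ?] /andP[? ?] /andP[? ?].
by apply/andP; split; lra.
Qed.

End birkhoff_continuous.

(** * Averages over shrinking balls *)

Lemma iter_lipschitz (R : realType) (X : metricType R) (L : R) (T : X -> X) :
  0 <= L -> metric_lipschitz L T ->
  forall i x y, mdist (iter i T x) (iter i T y) <= L ^+ i * mdist x y.
Proof.
move=> L0 TL; elim=> [|i IH] x y; first by rewrite expr0 mul1r.
rewrite exprS -mulrA (le_trans (TL _ _))// ler_wpM2l//; exact: IH.
Qed.

Lemma continuous_iter (X : topologicalType) (T : X -> X) i :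
  continuous T -> continuous (iter i T).
Proof.
move=> cT; elim: i => [|i IH] x; first exact: cvg_id.
exact: (continuous_comp (IH x) (cT _)).
Qed.

Section ball_averages.
Context (R : realType) (X : pmetricType R).
Variables (mu : probability (borel X) R) (T : X -> X) (L : R) (r : nat -> R).
Hypotheses (X_compact : compact [set: X]) (L_gt1 : 1 < L).
Hypotheses (T_cont : continuous T) (T_lip : metric_lipschitz L T).
Hypothesis r_le : exists gamma : R,
  forall k : nat, (0 < k)%N -> r k <= gamma * L ^- k.

(** The real counterpart of [average], applied below to real and imaginary parts. *)
Definition ball_average (x : X) (k : nat) (g : X -> R) : R :=
  (fine (mu (ball x (r k))))^-1 * Rintegral mu (ball x (r k)) g.

Lemma ball_average_dist_le x k (g : X -> R) (a e : R) : continuous g ->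
  (0 < mu (ball x (r k)))%E ->
  (forall y, ball x (r k) y -> `|g y - a| <= e) ->
  `|ball_average x k g - a| <= e.
Proof.
move=> cg muB ga; set B : set (borel X) := ball x (r k).
have mB : measurable B := ball_borel_measurable _ _.
have mg := continuous_borel_measurable cg.
have [C gC] := compact_continuous_bounded X_compact cg.
have ig : mu.-integrable B (EFin \o g).
  apply: (integrableS measurableT) => //.
  exact: (bounded_fun_integrable mu mg gC).
have ia : mu.-integrable B (EFin \o cst a).
  exact: finite_measure_integrable_cst.
have muB0 : 0 < fine (mu B).
  by rewrite fine_gt0// muB/= (le_lt_trans (probability_le1 mu mB))// ltry.
have := Rintegral_dist_le mB ig ia ga.
rewrite Rintegral_cst//= -ler_pdivrMr//; apply: le_trans.
rewrite -[X in _ / X](ger0_norm (ltW muB0)) -normf_div mulrBl mulfK ?gt_eqF//.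
by rewrite /ball_average mulrC.
Qed.

Lemma ball_average_cvg x (f : X -> R) (l : R) : continuous f ->
  (forall k, (0 < k)%N -> (0 < mu (ball x (r k)))%E) ->
  k%:R^-1 * (\sum_(0 <= i < k) f (iter i T x)) @[k --> \oo] --> l ->
  k%:R^-1 * (\sum_(0 <= i < k) ball_average x k (f \o iter i T)) @[k --> \oo]
    --> l.
Proof.
move=> cf muB fl; have [gamma r_gamma] := r_le.
have L0 : 0 < L by exact: lt_trans L_gt1.
have cfT i : continuous (f \o iter i T).
  by move=> y; apply: continuous_comp; [exact: continuous_iter|exact: cf].
have [C fC] := compact_continuous_bounded X_compact cf.
have C0 : 0 <= C := le_trans (normr_ge0 _) (fC x).
apply/cvgrPdist_le => e e0; have e30 : 0 < e / 3 by rewrite divr_gt0.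
have [d d0 dP] := compact_uniformly_continuous X_compact cf e30.
(* [m] counts the last indices [i < k] at which the image of the ball under [T^i] may be too large
   for uniform continuity. *)
have [m mP] : exists m : nat, forall j, (m <= j)%N -> gamma * L ^- j < d.
  have : gamma * L^-1 ^+ j @[j --> \oo] --> gamma * 0.
    apply: cvgMl_tmp; apply: cvg_expr.
    by rewrite ger0_norm ?invr_ge0 ?ltW// invf_lt1.
  rewrite mulr0 => /cvgrPdist_lt/(_ _ d0)[m _ mP]; exists m => j /mP /=.
  by rewrite sub0r normrN exprVn; apply: le_lt_trans; exact: ler_norm.
have avg_dist k i : (0 < k)%N ->
    `|ball_average x k (f \o iter i T) - f (iter i T x)| <= 2 * C.
  move=> k0; apply: ball_average_dist_le => [||y _] //; first exact: muB.
  rewrite (le_trans (ler_normB _ _))//.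
  by have /= := fC (iter i T y); have := fC (iter i T x); lra.
(* The image of the ball stays within [L ^+ i * r k <= gamma * L ^- (k - i) < d] of [T^i x], since
   [k - i >= m]. *)
have near_center k i : (0 < k)%N -> (i + m <= k)%N ->
    `|ball_average x k (f \o iter i T) - f (iter i T x)| <= e / 3.
  move=> k0 imk; apply: ball_average_dist_le => [||y] //; first exact: muB.
  rewrite ballEmdist/= distrC => xy; apply/ltW/dP.
  apply: le_lt_trans (iter_lipschitz (ltW L0) T_lip i x y) _.
  apply: lt_trans (_ : L ^+ i * r k < d).
    by rewrite ltr_pM2l// exprn_gt0.
  have imj : (m <= k - i)%N by rewrite leq_subRL ?(leq_trans (leq_addr _ _) imk).
  apply: le_lt_trans (mP _ imj).
  rewrite -ler_pdivlMl ?exprn_gt0// (le_trans (r_gamma _ k0))//.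
  rewrite mulrCA -invfM -exprD subnKC//.
  exact: leq_trans (leq_addr _ _) imk.
have /cvgrPdist_le/(_ _ e30) fl3 := fl.
near=> k.
have k0 : (0 < k)%N by near: k; exact: nbhs_infty_gt.
have mk : (m <= k)%N by near: k; exact: nbhs_infty_ge.
have kR0 : 0 < k%:R :> R by rewrite ltr0n.
have Ck : (2 * C) * m%:R <= e / 3 * k%:R.
  rewrite -ler_pdivrMl//.
  by near: k; exact: nbhs_infty_ger.
have lu : `|l - k%:R^-1 * (\sum_(0 <= i < k) f (iter i T x))| <= e / 3.
  by near: k.
have uv : `|\sum_(0 <= i < k) ball_average x k (f \o iter i T) -
    \sum_(0 <= i < k) f (iter i T x)| <= (e / 3 + e / 3) * k%:R.
  (* The first [k - m] terms err by at most [e / 3] each; the last [m] by at most [2 * C] each, and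
     their total is below [e / 3 * k] for large [k]. *)
  rewrite -sumrB (big_cat_nat (leq0n (k - m)) (leq_subr m k))/=.
  rewrite (le_trans (ler_normD _ _))// mulrDl lerD//.
    rewrite (le_trans (ler_norm_sum _ _ _))//.
    apply: (@le_trans _ _ (\sum_(0 <= i < k - m) e / 3)).
      rewrite !big_mkord; apply: ler_sum => i _; apply: near_center => //.
      by have := ltn_ord i; lia.
    rewrite big_const_nat subn0 iter_addr_0 -[_ *+ (k - m)]mulr_natr.
    by rewrite ler_wpM2l ?(ltW e30)// ler_nat leq_subr.
  apply: le_trans Ck; rewrite (le_trans (ler_norm_sum _ _ _))//.
  apply: (@le_trans _ _ (\sum_(k - m <= i < k) 2 * C)).
    by apply: ler_sum => i _; exact: avg_dist.
  by rewrite big_const_nat iter_addr_0 subKn// mulr_natr.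
have uvk : `|k%:R^-1 * (\sum_(0 <= i < k) ball_average x k (f \o iter i T)) -
    k%:R^-1 * (\sum_(0 <= i < k) f (iter i T x))| <= e / 3 + e / 3.
  by rewrite -mulrBr normrM ger0_norm ?invr_ge0// mulrC ler_pdivrMr.
rewrite (le_trans (ler_distD (k%:R^-1 * (\sum_(0 <= i < k) f (iter i T x))) _ _))//.
by rewrite [X in _ + X]distrC (le_trans (lerD lu uvk))//; lra.
Unshelve. all: by end_near. Qed.

End ball_averages.

(** * Passage between complex limits and real and imaginary parts *)

Section complex_limits.
Local Open Scope complex_scope.

Lemma Re_continuous (R : realType) (T : topologicalType) (f : T -> R[i]) :
  continuous f -> continuous (fun y => complex.Re (f y)).
Proof.
move=> cf x; apply/cvgrPdist_lt => e e0.
have eC0 : 0 < e%:C by rewrite ltcR.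
have /cvgrPdist_lt/(_ _ eC0) := cf x; apply: filterS => y.
rewrite -ltcR; apply: le_lt_trans.
by have := normc_ge_Re (f x - f y); case: (f x) => ? ?; case: (f y).
Qed.

Lemma normc_i (R : realType) : `|'i%C| = 1 :> R[i].
Proof. by rewrite normc_def /= expr0n/= add0r expr1n sqrtr1. Qed.

Lemma Im_continuous (R : realType) (T : topologicalType) (f : T -> R[i]) :
  continuous f -> continuous (fun y => complex.Im (f y)).
Proof.
move=> cf x; apply/cvgrPdist_lt => e e0.
have eC0 : 0 < e%:C by rewrite ltcR.
have /cvgrPdist_lt/(_ _ eC0) := cf x; apply: filterS => y.
rewrite -ltcR; apply: le_lt_trans.
(* Multiplication by ['i], of modulus 1, turns the imaginary part into a real part up to sign. *)
have := normc_ge_Re ((f x - f y) * 'i%C); rewrite ReiNIm normrN normrM.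
rewrite normc_i mulr1.
by case: (f x) => ? ?; case: (f y).
Qed.

Lemma cvg_complex (R : realType) (u v : nat -> R) (a b : R) :
  u k @[k --> \oo] --> a -> v k @[k --> \oo] --> b ->
  (u k +i* v k) @[k --> \oo] --> (a +i* b : R[i]).
Proof.
move=> ua vb; apply/cvgrPdist_lt => -[e e'].
(* In the order of [R[i]], a positive radius has zero imaginary part and positive real part. *)
rewrite ltcE/= => /andP[/eqP -> e0].
have e20 : 0 < e / 2 by rewrite divr_gt0.
have /cvgrPdist_lt/(_ _ e20) := ua; have /cvgrPdist_lt/(_ _ e20) := vb.
apply: filterS2 => k vk uk.
have -> : (a +i* b) - (u k +i* v k) = (a - u k)%:C + 'i%C * (b - v k)%:C.
  by simpc.
apply: (le_lt_trans (ler_normD _ _)); rewrite normrM normc_i mul1r.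
rewrite !normc_def/= expr0n/= !addr0 !sqrtr_sqr -rmorphD/= ltcR.
by rewrite [e]splitr ltrD.
Qed.

Lemma complex_avgE (R : realType) (q : R) (a b : nat -> R) (k : nat) :
  k%:R^-1 * (\sum_(0 <= i < k) q%:C * (a i +i* b i)) =
  (k%:R^-1 * (\sum_(0 <= i < k) q * a i)) +i*
  (k%:R^-1 * (\sum_(0 <= i < k) q * b i)) :> R[i].
Proof.
have -> : \sum_(0 <= i < k) q%:C * (a i +i* b i) =
    (\sum_(0 <= i < k) q * a i) +i* (\sum_(0 <= i < k) q * b i) :> R[i].
  elim: k => [|k IH]; first by rewrite !big_geq.
  by rewrite !big_nat_recr//= IH; simpc.
have -> : k%:R^-1 = (k%:R^-1)%:C :> R[i] by rewrite fmorphV rmorph_nat.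
by simpc.
Qed.

End complex_limits.

Theorem theorem3p10 (R : realType) (X : pmetricType R)
    (X_compact : compact [set: X])
    (T : X -> X) (L : R) (L_gt1 : 1 < L)
    (T_homeo : homeomorphism T) (T_lip : metric_lipschitz L T)
    (mu : probability (borel X) R) (mu_regular : regular_measure mu)
    (T_ergodic : ergodic mu T)
    (r : nat -> R) (r_gt0 : forall k : nat, (0 < k)%N -> 0 < r k)
    (r_le : exists gamma : R,
      forall k : nat, (0 < k)%N -> r k <= gamma * L ^- k) :
  {ae mu, forall x : X,
    (forall k : nat, (0 < k)%N -> (0 < mu (ball x (r k)))%E) /\
    (forall f : X -> R[i], continuous f ->
       k%:R^-1 *
         (\sum_(0 <= i < k) average mu (ball x (r k)) (f \o iter i T))
       @[k --> \oo] --> cintegral mu [set: X] f)}.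
Proof.
have T_cont := T_homeo.1.
(* Both exceptional null sets are independent of [f], so [x] is fixed before [f] is introduced. *)
apply: (@filterS2 (borel X) (almost_everywhere mu) _ _ _ _ _
  (ball_mass_gt0 mu X_compact) (birkhoff_continuous X_compact T_ergodic)).
move=> x mu_ball birk; split => [k k0|f cf]; first exact/mu_ball/r_gt0.
have muB k : (0 < k)%N -> (0 < mu (ball x (r k)))%E.
  by move=> k0; exact/mu_ball/r_gt0.
have cRe := Re_continuous cf; have cIm := Im_continuous cf.
have cvgRe := ball_average_cvg X_compact L_gt1 T_cont T_lip r_le cRe muB (birk _ cRe).
have cvgIm := ball_average_cvg X_compact L_gt1 T_cont T_lip r_le cIm muB (birk _ cIm).
have := cvg_complex cvgRe cvgIm; apply: cvg_trans; apply: near_eq_cvg.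
by apply: nearW => k; rewrite complex_avgE.
Qed.
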